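(* For every state space $K_A$ there is a constant $\lambda_A\in\mathbb R_{+}$, depending solely on $K_A$, such that for every state space $K_B$ and every $x_{AB}\in K_A\hat\otimes K_B$, $$I(A:B)_{x_{AB}}\le \lambda_A\,(1+\ln\lambda_A).$$
   Context: A state space is a nonempty compact convex subset $K$ of a finite-dimensional real vector space. $A(K)$ is the space of affine functions $K\to\mathbb R$, $A(K)^+$ the cone of nonnegative ones, $1_K$ the constant function $1$, and $E(K)=\{f\in A(K):0\le f\le 1_K\}$ the set of effects. $A(K)^\star$ is the dual space with dual cone $A(K)^{\star+}$; $K$ is identified, via evaluation, with $\{\phi\in A(K)^{\star+}:\langle\phi,1_K\rangle=1\}$, and elements of $A(K)$ act linearly on $A(K)^\star$. $K_A\hat\otimes K_B$ is the state space of all $z\in A(K_A)^\star\otimes A(K_B)^\star$ with $(f\otimes g)(z)\ge0$ for all $f\in A(K_A)^+$, $g\in A(K_B)^+$ and $(1_{K_A}\otimes1_{K_B})(z)=1$. The reduced state of $x_{AB}$ on $B$ is $x_B=(1_{K_A}\otimes\mathrm{id}_B)(x_{AB})\in K_B$. The relative entropy of $x,y\in K$ is $$D(x\Vert y)=\int_{\mathbb R}\frac{dt}{|t|(t-1)^2}\,\sup_{f\in E(K)}-\big[(1-t)f(x)+tf(y)\big]\in[0,\infty].$$ The mutual information of $x_{AB}\in K_A\hat\otimes K_B$ is $$I(A:B)_{x_{AB}}=\inf_{y_A\in K_A}D(x_{AB}\Vert y_A\otimes x_B),$$ where $D$ is taken in the state space $K_A\hat\otimes K_B$. *)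

(* Defs.v *)
From HB Require Import structures.
From mathcomp Require Import all_boot all_order all_algebra.
From mathcomp Require Import all_classical all_reals all_analysis.
Set Implicit Arguments.
Unset Strict Implicit.
Unset Printing Implicit Defensive.
Import Order.TTheory GRing.Theory Num.Theory.
Import numFieldNormedType.Exports.
Local Open Scope classical_set_scope.
Local Open Scope ring_scope.

(* The topology of the finite-dimensional space V is its unique Hausdorff
   vector space topology, read off in the coordinates of a basis. *)
Definition state_space (R : realType) (V : vectType R) (K : set V) : Prop :=
  [/\ K !=set0, compact [set passmx.rVof (vbasis {:V}) x | x in K] & convex_set K].

Section AffineFunctions.
Context {R : realType} {V : lmodType R}.
Implicit Type K : set V.

(* The functions live on the subtype K, so two affine functions are equal as
   soon as they agree on K; z is the point t x + (1 - t) y of K. *)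
Definition is_affine K (f : K -> R^o) : Prop :=
  forall (t : R) (x y z : K), 0 <= t <= 1 ->
    val z = t *: val x + (1 - t) *: val y ->
    f z = t * f x + (1 - t) * f y.

Definition affine_pred K : {pred K -> R^o} := [pred f | `[< is_affine f >]].

Lemma affine_predP K (f : K -> R^o) :
  reflect (is_affine f) (f \in @affine_pred K).
Proof. exact: asboolP. Qed.

Record affine_fun K := AffineFun {
  affine_val :> K -> R^o ;
  affine_valP : affine_val \in @affine_pred K }.

HB.instance Definition _ K := [isSub for @affine_val K].
HB.instance Definition _ K := [Choice of affine_fun K by <:].

Fact affine_submod_closed K : submod_closed (@affine_pred K).
Proof.
split.
  by apply/affine_predP => t x y z _ _; rewrite !mulr0 addr0.
move=> a f g /affine_predP hf /affine_predP hg.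
apply/affine_predP => t x y z t01 zE.
rewrite [LHS](_ : _ = a * f z + g z) // (hf t x y z) // (hg t x y z) //.
rewrite [X in _ = t * X + _](_ : _ = a * f x + g x) //.
rewrite [X in _ = _ + _ * X](_ : _ = a * f y + g y) //.
by rewrite !mulrDr !mulrA ![a * _]mulrC addrACA.
Qed.

HB.instance Definition _ K :=
  GRing.isSubmodClosed.Build R (K -> R^o) (@affine_pred K)
    (affine_submod_closed K).
HB.instance Definition _ K := [SubChoice_isSubLmodule of affine_fun K by <:].

Fact affine_one_subproof K : (fun=> 1) \in @affine_pred K.
Proof.
by apply/affine_predP => t x y z _ _; rewrite !mulr1 addrC subrK.
Qed.

Definition affine_one K : affine_fun K := AffineFun (affine_one_subproof K).

Definition affine_pos K : set (affine_fun K) := [set f | forall x, 0 <= f x].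

Definition effects K : set (affine_fun K) :=
  [set f | forall x, 0 <= f x <= 1].

End AffineFunctions.

Arguments affine_one {R V} K.
Arguments effects {R V} K.

Section RelativeEntropy.
Context {R : realType} {V : lmodType R}.

(* At t = 0 and t = 1 the weight is (0^-1)%R = 0 rather than infinite; these
   two points are Lebesgue-null. *)
Definition relative_entropy (K : set V) (x y : K) : \bar R :=
  (\int[@lebesgue_measure R]_t
    ((`|t| * (t - 1) ^+ 2)^-1%:E *
     ereal_sup [set (- ((1 - t) * f x + t * f y))%:E | f in effects K]))%E.

End RelativeEntropy.

Section TensorProduct.
Context {R : realType} {VA VB : lmodType R}.
Variables (KA : set VA) (KB : set VB).

(* The tensor product of the duals of A(KA) and A(KB) is realized inside the
   space of functions of two arguments f in A(KA) and g in A(KB), as the finite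
   sums of elementary tensors phi (x) psi : (f, g) |-> phi f * psi g; the value
   z f g is then (f (x) g)(z). *)
Definition tensor (phi : affine_fun KA -> R) (psi : affine_fun KB -> R) :
    affine_fun KA -> affine_fun KB -> R^o :=
  fun f g => phi f * psi g.

Definition dual_tensor : set (affine_fun KA -> affine_fun KB -> R^o) :=
  [set z | exists n (phi : 'I_n -> {scalar (affine_fun KA)})
                    (psi : 'I_n -> {scalar (affine_fun KB)}),
     z = \sum_(i < n) tensor (phi i) (psi i)].

Definition max_tensor : set (affine_fun KA -> affine_fun KB -> R^o) :=
  [set z | [/\ dual_tensor z,
     (forall f g, affine_pos f -> affine_pos g -> 0 <= z f g) &
     z (affine_one KA) (affine_one KB) = 1]].

(* The identification of a point y of KA with the evaluation at y. *)
Definition eval_at (y : KA) : affine_fun KA -> R := fun f => f y.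

Fact eval_at_scalar (y : KA) : scalar (eval_at y).
Proof. by []. Qed.

HB.instance Definition _ (y : KA) :=
  GRing.isLinear.Build R (affine_fun KA) R *%R (eval_at y) (eval_at_scalar y).

(* (1 (x) id)(z), an element of the dual of A(KB). *)
Definition reduced_state (z : max_tensor) : affine_fun KB -> R :=
  val z (affine_one KA).

Fact reduced_state_scalar (z : max_tensor) : scalar (reduced_state z).
Proof.
case: z => z zP; rewrite /reduced_state /=.
move: zP; rewrite inE => -[[n [phi [psi ->]]] _ _] a g h.
have E f g' : (\sum_(i < n) tensor (phi i) (psi i)) f g' =
    \sum_(i < n) phi i f * psi i g' by rewrite !fct_sumE.
rewrite !E mulr_sumr -big_split; apply: eq_bigr => i _ /=.
by rewrite linearP mulrDr mulrCA.
Qed.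

HB.instance Definition _ (z : max_tensor) :=
  GRing.isLinear.Build R (affine_fun KB) R *%R (reduced_state z)
    (reduced_state_scalar z).

Fact product_state_subproof (y : KA) (z : max_tensor) :
  tensor (eval_at y) (reduced_state z) \in max_tensor.
Proof.
have := valP z; rewrite !inE => -[_ z_ge0 z1]; split.
- exists 1%N, (fun=> eval_at y : {scalar (affine_fun KA)}),
    (fun=> reduced_state z : {scalar (affine_fun KB)}).
  by rewrite big_ord1.
- move=> f g f0 g0; apply: mulr_ge0; first exact: f0.
  by apply: z_ge0 => // x; exact: ler01.
- by rewrite /tensor [eval_at _ _]/= mul1r.
Qed.

Definition product_state (y : KA) (z : max_tensor) : max_tensor :=
  exist (fun w => w \in max_tensor) _ (product_state_subproof y z).

Definition mutual_information (x : max_tensor) : \bar R :=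
  ereal_inf [set relative_entropy x (product_state y x) | y in [set: KA]].

End TensorProduct.

Arguments max_tensor {R VA VB} KA KB.

(* Main.v *)
From HB Require Import structures.
Require Import Defs.
From mathcomp Require Import all_boot all_order all_algebra.
From mathcomp Require Import all_classical all_reals all_analysis.
From mathcomp Require Import measurable_realfun.
From mathcomp Require Import ring lra.
Set Implicit Arguments.
Unset Strict Implicit.
Unset Printing Implicit Defensive.
Import Order.TTheory GRing.Theory Num.Theory.
Import numFieldNormedType.Exports.
Local Open Scope classical_set_scope.
Local Open Scope ring_scope.

(** The mutual information is an infimum over y_A, so one well chosen y_A
    suffices, and it must not depend on x_AB.  Because K_A is
    finite-dimensional and bounded, it has a point y that contains every point
    x of K_A as a convex component with one and the same weight 1/l:
    y = x/l + (1 - 1/l) z with z in K_A depending on x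
    ([exists_dominating_point]).  This is the only place where the geometry of
    K_A enters.

    Such a y satisfies f <= l f(y) 1 on K_A for every nonnegative affine f,
    and this inequality of functions can be tensored with any nonnegative g:
    x_AB(f, g) <= l f(y) x_AB(1, g) = l (y (x) x_B)(f, g).  So y (x) x_B in turn
    contains x_AB with weight 1/l, now inside the maximal tensor product
    ([product_dominates]), whatever K_B and x_AB are.

    It remains to bound D(x || y) by a function of l when y contains x with
    weight 1/l.  Then f(x) <= l f(y) for each effect f.  The singularity of the
    weight at t = 0 is harmless because the supremum is at most |t| for t < 0
    and vanishes on [0, 1]; the double pole at t = 1 is harmless because the
    supremum vanishes until t = l / (l - 1), where f(x) <= l f(y) stops forcing
    (1 - t) f(x) + t f(y) >= 0.  Beyond that point the supremum is at most
    t - 1.  These estimates combine into the single majorant 2 l / (1 + t^2) of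
    the integrand ([hypothesis_testing_le], [integrand_bounds]), whose integral
    is 2 l pi ([relative_entropy_le]).  As 2 l pi >= 1, the constant
    lambda = 2 l pi satisfies lambda <= lambda (1 + ln lambda). *)

(** * Convex combinations and a dominating point of a state space *)

Lemma convex_set_comb (R : realType) (V : lmodType R) (K : set V) (t : R)
    (x y : V) :
  convex_set K -> 0 <= t <= 1 -> K x -> K y -> K (t *: x + (1 - t) *: y).
Proof.
move=> Kconv /andP[t0 t1] Kx Ky.
by have := Kconv x y (Itv01 t0 t1) (mem_set Kx) (mem_set Ky); rewrite inE.
Qed.

(** Induction on the number of points: the first n points are averaged with the
    renormalized weights c i / s, and the result is mixed with the last one. *)
Lemma convex_set_sum (R : realType) (V : lmodType R) (K : set V) (n : nat)
    (c : 'I_n -> R) (p : 'I_n -> V) :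
  convex_set K -> (forall i, 0 <= c i) -> \sum_i c i = 1 ->
  (forall i, K (p i)) -> K (\sum_i c i *: p i).
Proof.
move=> Kconv; elim: n c p => [|n IH] c p c0 c1 Kp.
  by move: c1; rewrite big_ord0 => /esym/eqP; rewrite oner_eq0.
rewrite big_ord_recr /=; move: c1; rewrite big_ord_recr /=.
set s := \sum_(i < n) _ => c1.
have s0 : 0 <= s by apply: sumr_ge0.
(* When s = 0 the renormalization fails: all the mass is on the last point. *)
have [s_eq0|s_neq0] := eqVneq s 0.
  have cE i : c (widen_ord (leqnSn n) i) = 0.
    apply/eqP; have /eqP := s_eq0.
    by rewrite psumr_eq0 // => /allP/(_ i); rewrite mem_index_enum; apply.
  rewrite big1 => [|i _]; last by rewrite cE scale0r.
  by move: c1; rewrite s_eq0 !add0r => ->; rewrite scale1r.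
have Kq : K (\sum_(i < n) (c (widen_ord (leqnSn n) i) / s) *:
               p (widen_ord (leqnSn n) i)).
  apply: IH => // [i|]; first by rewrite divr_ge0.
  by rewrite -mulr_suml mulfV.
have s1 : 0 <= s <= 1 by rewrite s0 -c1 lerDl /=.
have := convex_set_comb Kconv s1 Kq (Kp ord_max).
have -> : 1 - s = c ord_max by rewrite -c1 addrAC subrr add0r.
rewrite scaler_sumr; congr (K (_ + _)); apply: eq_bigr => i _.
by rewrite scalerA mulrC divfK.
Qed.

Lemma compact_bounded_scalar (R : realType) (V : vectType R) (K : set V)
    (phi : {scalar V}) :
  compact [set passmx.rVof (vbasis {:V}) x | x in K] ->
  exists M, forall x, K x -> `|phi x| <= M.
Proof.
move=> /compact_bounded[B [_ HB]].
pose e := vbasis {:V}.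
exists (\sum_(i < \dim {:V}) (B + 1) * `|phi e`_i|) => x Kx.
rewrite {1}(coord_vbasis (memvf x)) linear_sum.
apply: (le_trans (ler_norm_sum _ _ _)); apply: ler_sum => i _.
rewrite linearZ normrM ler_wpM2r //.
have /= := HB (B + 1) _ (passmx.rVof e x) (ex_intro2 _ _ _ Kx erefl).
rewrite ltrDl ltr01 => /(_ erefl); apply: le_trans.
have -> : coord e i x = passmx.rVof e x ord0 i by rewrite mxE.
rewrite [leRHS]/Num.norm /= mx_normrE.
exact: (le_bigmax _ (fun ij : 'I_1 * 'I_(\dim {:V}) =>
  `|passmx.rVof e x ij.1 ij.2|) (ord0, i)).
Qed.

(** Lifting x to (x, 1) turns affine coordinates into linear ones.  A free
    family of lifted points of maximal length spans all lifted points; the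
    second component of (x, 1) = \sum_i c i *: (p i, 1) says that the c i add up
    to 1.  Each c i is an affine function of x, hence bounded on K.  The c i may
    be negative. *)
Lemma bounded_affine_coordinates (R : realType) (V : vectType R) (K : set V) :
  state_space K ->
  exists (n : nat) (p : 'I_n -> V) (M : R), (forall i, K (p i)) /\
    forall x, K x -> exists c : 'I_n -> R,
      [/\ \sum_i c i = 1, x = \sum_i c i *: p i & forall i, c i <= M].
Proof.
move=> [_ Kcomp _]; pose W : vectType R := (V * R^o)%type.
pose lifted (v : W) := exists2 x, K x & v = (x, 1).
(* P n is boolean and its solutions are bounded by the dimension, so that a
   largest one exists. *)
pose P n := `[< exists X : n.-tuple W,
  free X /\ forall i : 'I_n, lifted X`_i >].
have P0 : P 0%N by apply/asboolP; exists [tuple]; split; [exact: nil_free|case].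
have Pmax n : P n -> (n <= \dim {:W})%N.
  move=> /asboolP[X [/eqP dimX _]].
  by rewrite -(size_tuple X) -dimX dimvS ?subvf.
case: (ex_maxnP (ex_intro _ 0%N P0) Pmax) => n /asboolP[X [freeX liftX]] nmax.
have spanX x : K x -> ((x, 1) : W) \in <<X>>%VS.
  move=> Kx; apply/negP => /negP xX.
  suff /nmax : P n.+1 by rewrite ltnn.
  apply/asboolP; exists [tuple of ((x, 1) : W) :: X]; split.
    by rewrite free_cons xX.
  case=> [[|i] /= ilt]; first by exists x.
  exact: (liftX (Ordinal (ilt : (i < n)%N))).
pose p (i : 'I_n) : V := (X`_i).1.
pose inl_lin (x : V) : W := (x, 0).
have inl_is_linear : linear inl_lin.
  by move=> a u v; congr pair; rewrite /= addr0; symmetry; exact: mulr0.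
pose inlM := GRing.isLinear.Build R V W *:%R inl_lin inl_is_linear.
pose inlL : {linear V -> W} := HB.pack inl_lin inlM.
(* The constant (0, 1) is split off to leave a linear form in x. *)
have bnd i : exists M, forall x, K x -> coord X i (x, 1) <= M.
  have [M HM] := compact_bounded_scalar (coord X i \o inlL) Kcomp.
  exists (M + coord X i ((0, 1) : W)) => x Kx.
  have -> : (x, 1) = inl_lin x + (0, 1) :> W.
    by congr pair; rewrite /= ?addr0 ?add0r.
  by rewrite linearD lerD2r (le_trans (ler_norm _)) // HM.
have [M HM] := choice bnd.
exists n, p, (\sum_i `|M i|); split=> [i|x Kx].
  by rewrite /p; have [y Ky ->] := liftX i.
exists (fun i => coord X i (x, 1)).
have xE := coord_span (spanX x Kx).
split.
- have := congr1 snd xE; rewrite /= raddf_sum /= => E2.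
  rewrite [RHS]E2; apply: eq_bigr => i _; have [y _ ->] := liftX i.
  by rewrite /= [_ *: _]mulr1.
- by have := congr1 fst xE; rewrite /= raddf_sum.
- move=> i; rewrite (le_trans (HM i x Kx)) // (le_trans (ler_norm _)) //.
  by rewrite (bigD1 i) //= lerDl sumr_ge0.
Qed.

(** The point y is a mixture containing x with weight 1/l.  For l > 1 this is
    the order relation x <= l y of the cone over K, expressed without the
    cone. *)
Definition dominates (R : realType) (V : lmodType R) (K : set V) (l : R)
    (y x : V) : Prop :=
  exists2 z, K z & y = l^-1 *: x + (1 - l^-1) *: z.

(** The barycenter y of the points p i works.  With affine coordinates c of x,
    the coordinates 1/N - (c i)/l of y - x/l become nonnegative once l exceeds
    N times the bound M on the c i, and they add up to 1 - 1/l. *)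
Lemma exists_dominating_point (R : realType) (V : vectType R) (K : set V) :
  state_space K ->
  exists (y : V) (l : R), [/\ K y, 1 < l & forall x, K x -> dominates K l y x].
Proof.
move=> Kss; have [n [p [M [Kp pP]]]] := bounded_affine_coordinates Kss.
have [[x0 Kx0] _ Kconv] := Kss.
have n0 : 0 < n%:R :> R.
  rewrite ltr0n; have [c [c1 _ _]] := pP _ Kx0; case: (n) c c1 => // c.
  by rewrite big_ord0 => /esym/eqP; rewrite oner_eq0.
(* The summand 2 only serves to get 1 < l. *)
pose N : R := n%:R; pose l := 2 + N * `|M|.
have l1 : 1 < l by rewrite ltr_wpDr ?ltr1n // mulr_ge0 // ltW.
have l0 : 0 < l by exact: lt_trans l1.
have sumN : \sum_(i < n) N^-1 = 1 :> R.
  by rewrite sumr_const card_ord -[LHS]mulr_natr mulVf // gt_eqF.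
exists (\sum_i N^-1 *: p i), l; split=> // [|x Kx].
  by apply: convex_set_sum => // i; rewrite invr_ge0 ltW.
have [c [c1 xE cM]] := pP x Kx.
have l1V : 1 - l^-1 != 0 by rewrite subr_eq0 eq_sym invr_eq1 gt_eqF.
exists (\sum_i ((N^-1 - l^-1 * c i) / (1 - l^-1)) *: p i).
  apply: convex_set_sum => // [i|].
    apply: divr_ge0; last by rewrite subr_ge0 invf_le1 ?ltW.
    have ciM : N * c i <= l.
      rewrite ler_wpDl // ler_wpM2l ?(ltW n0) //.
      exact: le_trans (cM i) (ler_norm M).
    by rewrite subr_ge0 ler_pdivrMl // -mulrC ler_pdivlMl.
  by rewrite -mulr_suml sumrB sumN -mulr_sumr c1 mulr1 divff.
rewrite {1}xE !scaler_sumr -big_split; apply: eq_bigr => i _ /=.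
by rewrite !scalerA -scalerDl [X in _ + X]mulrC divfK // addrC subrK.
Qed.

Lemma dominates_le (R : realType) (V : lmodType R) (K : set V) (l : R)
    (x y : K) (f : affine_fun K) :
  1 <= l -> dominates K l (val y) (val x) -> affine_pos f -> f x <= l * f y.
Proof.
move=> l1 [z Kz yE] f0; have l0 : 0 < l by exact: lt_le_trans l1.
have lV : 0 <= l^-1 <= 1 by rewrite invr_ge0 ltW //= invf_le1.
have /affine_predP fa := affine_valP f.
rewrite (fa l^-1 x (exist _ z (mem_set Kz)) y) // mulrDr mulrA mulfV ?gt_eqF //.
rewrite mul1r lerDl !mulr_ge0 ?f0 ?(ltW l0) // subr_ge0.
by case/andP: lV.
Qed.

(** * A bound on the relative entropy *)

(** Here a = f(x) and b = f(y) for an effect f.  For t < 0 the left factor is at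
    most -t, and 1 + t^2 <= (t - 1)^2.  On [0, 1] it is nonpositive.  For t > 1
    the hypothesis a <= l b makes it at most a (t - 1 - t/l): this is nonpositive
    when l (t - 1) <= t, and otherwise the left factor is still at
    most t - 1, while t < l (t - 1) and 1 + t^2 <= 2 t^2. *)
Lemma hypothesis_testing_le (R : realType) (l a b t : R) :
  1 <= l -> 0 <= a <= 1 -> 0 <= b <= 1 -> a <= l * b ->
  - ((1 - t) * a + t * b) * (1 + t ^+ 2) <= 2 * l * (`|t| * (t - 1) ^+ 2).
Proof.
move=> l1 /andP[a0 a1] /andP[b0 b1] ab.
have [t0|t0] := ltP t 0.
  rewrite ltr0_norm //.
  have loss : - ((1 - t) * a + t * b) <= - t by nra.
  have sq : 1 + t ^+ 2 <= (t - 1) ^+ 2 by nra.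
  have t1 : 0 <= 1 + t ^+ 2 by nra.
  apply: le_trans (ler_wpM2r t1 loss) _.
  have tN : 0 <= - t by lra.
  apply: le_trans (ler_wpM2l tN sq) _.
  by rewrite ler_peMl ?(mulr_ge0 tN (sqr_ge0 _)) //; lra.
rewrite ger0_norm //.
have rhs0 : 0 <= 2 * l * (t * (t - 1) ^+ 2).
  by apply: mulr_ge0; [lra | exact: mulr_ge0 t0 (sqr_ge0 _)].
have [t1|t1] := leP t 1.
  apply: le_trans rhs0.
  rewrite mulNr oppr_le0 mulr_ge0 ?addr_ge0 ?sqr_ge0 //.
    by rewrite mulr_ge0 // subr_ge0.
  by rewrite mulr_ge0.
have [far|near] := leP (l * (t - 1)) t.
  apply: le_trans rhs0.
  rewrite mulNr oppr_le0; apply: mulr_ge0; last by nra.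
  rewrite -(pmulr_rge0 _ (lt_le_trans ltr01 l1)).
  have -> : l * ((1 - t) * a + t * b) =
            a * (t - l * (t - 1)) + t * (l * b - a) by ring.
  by rewrite addr_ge0 // mulr_ge0 // subr_ge0.
have loss : - ((1 - t) * a + t * b) <= t - 1 by nra.
have sq : 1 + t ^+ 2 <= 2 * (t * t) by nra.
have t2 : 0 <= 1 + t ^+ 2 by nra.
apply: le_trans (ler_wpM2r t2 loss) _.
have tN : 0 <= t - 1 by lra.
apply: le_trans (ler_wpM2l tN sq) _.
have -> : 2 * l * (t * (t - 1) ^+ 2) = (t - 1) * (2 * (t * (l * (t - 1)))).
  by ring.
by rewrite !ler_wpM2l // ltW.
Qed.

(** At t = 0 and t = 1 the weight is the inverse of 0, which is 0, and the
    pointwise estimate has to be replaced by this convention. *)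
Lemma integrand_bounds (R : realType) (V : lmodType R) (K : set V) (l : R)
    (x y : K) (t : R) :
  1 <= l -> dominates K l (val y) (val x) ->
  (0 <= (`|t| * (t - 1) ^+ 2)^-1%:E *
     ereal_sup [set (- ((1 - t) * f x + t * f y))%:E | f in effects K] <=
   (2 * l * (oneDsqr t)^-1)%:E)%E.
Proof.
move=> l1 xy; set w := `|t| * _; set S := ereal_sup _.
have w0 : 0 <= w by rewrite mulr_ge0 ?sqr_ge0.
have q0 : 0 < oneDsqr t by rewrite (lt_le_trans ltr01) ?oneDsqr_ge1.
have S0 : (0 <= S)%E.
  (* the effect 0 witnesses that the supremum is nonnegative *)
  apply: ereal_sup_ubound; exists (0 : affine_fun K).
    by move=> z; rewrite lexx ler01.
  by rewrite [LHS](_ : _ = (- ((1 - t) * 0 + t * 0))%:E) // !mulr0 addr0 oppr0.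
apply/andP; split; first by rewrite mule_ge0 // lee_fin invr_ge0.
have [w_eq0|w_neq0] := eqVneq w 0.
  rewrite w_eq0 invr0 mul0e lee_fin.
  by rewrite !mulr_ge0 ?invr_ge0 ?(ltW q0) // (le_trans ler01).
have w_gt0 : 0 < w by rewrite lt0r w_neq0.
rewrite muleC lee_pdivrMr //.
apply: ge_ereal_sup => _ [f fE <-].
rewrite -EFinM lee_fin mulrAC ler_pdivlMr //.
have /andP[fx0 fx1] := fE x; have /andP[fy0 fy1] := fE y.
apply: hypothesis_testing_le; rewrite ?fx0 ?fy0 //.
by apply: dominates_le => // z; case/andP: (fE z).
Qed.

Lemma integral_oneDsqr (R : realType) :
  (\int[@lebesgue_measure R]_t (oneDsqr t)^-1%:E)%E = pi%:E.
Proof.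
rewrite ge0_symfun_integralT.
- have -> : [set t : R | 0 <= t] = `[0, +oo[%classic.
    by apply/seteqP; split => t /=; rewrite in_itv /= andbT.
  by rewrite integral0y_oneDsqr -EFinM mulrC divfK.
- by move=> t; rewrite invr_ge0 (le_trans ler01) ?oneDsqr_ge1.
- exact: continuous_oneDsqrV.
- by move=> t /=; rewrite /oneDsqr sqrrN.
Qed.

(** The integral of a nonnegative function is by definition a supremum over the
    simple functions below it, so monotonicity needs no measurability.  This
    avoids a discussion of the measurability of the supremum over effects in the
    relative entropy. *)
Lemma ge0_le_integral_nonmeasurable d (T : measurableType d) (R : realType)
    (mu : {measure set T -> \bar R}) (f g : T -> \bar R) :
  (forall t, 0 <= f t <= g t)%E -> (\int[mu]_t f t <= \int[mu]_t g t)%E.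
Proof.
move=> fg.
have f0 t : (0 <= f t)%E by case/andP: (fg t).
have fleg t : (f t <= g t)%E by case/andP: (fg t).
have g0 t : (0 <= g t)%E by exact: le_trans (fleg t).
rewrite !ge0_integralTE //.
apply: le_ereal_sup => _ [h hf <-]; exists h => // t.
exact: le_trans (hf t) (fleg t).
Qed.

Lemma relative_entropy_le (R : realType) (V : lmodType R) (K : set V) (l : R)
    (x y : K) :
  1 <= l -> dominates K l (val y) (val x) ->
  (relative_entropy x y <= (2 * l * pi)%:E)%E.
Proof.
move=> l1 xy.
apply: (@le_trans _ _
  (\int[@lebesgue_measure R]_t (2 * l * (oneDsqr t)^-1)%:E)%E).
  by apply: ge0_le_integral_nonmeasurable => t; exact: integrand_bounds.
under eq_integral do rewrite EFinM.
rewrite ge0_integralZl //.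
- by rewrite integral_oneDsqr -EFinM.
- apply/measurable_EFinP; apply: continuous_measurable_fun.
  exact: continuous_oneDsqrV.
- by rewrite lee_fin mulr_ge0 // (le_trans ler01).
Qed.

(** * Domination in the maximal tensor product *)

Section MaximalTensorProduct.
Context {R : realType} {VA VB : lmodType R}.
Variables (KA : set VA) (KB : set VB).

Lemma dual_tensor_comb (a b : R) (z w : affine_fun KA -> affine_fun KB -> R^o) :
  dual_tensor z -> dual_tensor w -> dual_tensor (a *: z + b *: w).
Proof.
move=> [n [phi [psi ->]]] [m [phi' [psi' ->]]].
exists (n + m)%N,
  (fun i : 'I_(n + m) => match fintype.split i with
     | inl j => a \*o phi j : {scalar affine_fun KA}
     | inr j => b \*o phi' j
     end),
  (fun i : 'I_(n + m) => match fintype.split i with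
     | inl j => psi j
     | inr j => psi' j
     end).
rewrite big_split_ord /= !scaler_sumr; congr (_ + _);
  apply: eq_bigr => i _; apply/funext => f; apply/funext => g.
- by rewrite (unsplitK (inl i)) /tensor /= -mulrA.
- by rewrite (unsplitK (inr i)) /tensor /= -mulrA.
Qed.

Lemma dual_tensorBl (z : affine_fun KA -> affine_fun KB -> R^o)
    (f h : affine_fun KA) g :
  dual_tensor z -> z (f - h) g = z f g - z h g.
Proof.
move=> [n [phi [psi ->]]]; rewrite !fct_sumE -sumrB.
by apply: eq_bigr => i _; rewrite /tensor linearB mulrBl.
Qed.

Lemma dual_tensorZl (z : affine_fun KA -> affine_fun KB -> R^o) (a : R)
    (f : affine_fun KA) g :
  dual_tensor z -> z (a *: f) g = a * z f g.
Proof.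
move=> [n [phi [psi ->]]]; rewrite !fct_sumE mulr_sumr.
by apply: eq_bigr => i _; rewrite /tensor linearZ mulrA.
Qed.

(** The complementary component z = (y (x) x_B - x/l) / (1 - 1/l) takes on (f, g)
    a positive multiple of the value of x at (f(y) 1 - f/l, g).  It is therefore
    positive: f(y) 1 - f/l is a nonnegative affine function because y dominates
    every point of KA. *)
Lemma product_dominates (l : R) (y : KA) (x : max_tensor KA KB) :
  1 < l -> (forall w, KA w -> dominates KA l (val y) w) ->
  dominates (max_tensor KA KB) l (val (product_state y x)) (val x).
Proof.
move=> l1 ydom; have l0 : 0 < l by exact: lt_trans l1.
have lV : 0 < 1 - l^-1 by rewrite subr_gt0 invf_lt1.
have /set_mem[xdual xpos x1] := valP x.
have /set_mem[ydual _ y1] := valP (product_state y x).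
pose z := (- ((1 - l^-1)^-1 * l^-1)) *: val x +
          (1 - l^-1)^-1 *: val (product_state y x).
have zE f g : z f g = (1 - l^-1)^-1 * (f y * val x (affine_one KA) g -
                                       l^-1 * val x f g).
  rewrite [LHS](_ : _ = - ((1 - l^-1)^-1 * l^-1) * val x f g +
    (1 - l^-1)^-1 * (f y * val x (affine_one KA) g)) //.
  by rewrite mulrBr mulNr -mulrA addrC.
exists z; last first.
  rewrite scalerDr !scalerA mulrN mulVKf ?gt_eqF // mulfV ?gt_eqF //.
  by rewrite scale1r scaleNr addNKr.
split; first exact: dual_tensor_comb.
- move=> f g f0 g0; rewrite zE mulr_ge0 ?invr_ge0 ?(ltW lV) //.
  rewrite -!dual_tensorZl // -dual_tensorBl //.
  apply: xpos => // w.
  rewrite [leRHS](_ : _ = f y * 1 - l^-1 * f w) // mulr1 subr_ge0.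
  rewrite ler_pdivrMl //.
  by apply: dominates_le => //; [exact: ltW|exact/ydom/set_mem/valP].
- by rewrite zE x1 !mulr1 mulVf // gt_eqF.
Qed.

End MaximalTensorProduct.

(** * The bound on the mutual information *)

Theorem proposition3p5 (R : realType) (VA : vectType R) (KA : set VA)
    (hKA : state_space KA) :
  exists2 lambda : R, 0 < lambda &
    forall (VB : vectType R) (KB : set VB), state_space KB ->
    forall xAB : max_tensor KA KB,
      (mutual_information xAB <= (lambda * (1 + ln lambda))%:E)%E.
Proof.
have [y [l [Ky l1 ydom]]] := exists_dominating_point hKA.
have pi1 : 1 <= pi :> R by rewrite (le_trans _ (pi_ge2 R)) ?ler1n.
have lambda1 : 1 <= 2 * l * pi.
  by rewrite !mulr_ege1 ?ler1n // ltW.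
exists (2 * l * pi) => [|VB KB _ xAB]; first exact: lt_le_trans lambda1.
apply: (@le_trans _ _ (2 * l * pi)%:E); last first.
  by rewrite lee_fin ler_peMr ?(le_trans ler01) // lerDl ln_ge0.
pose yA : KA := exist _ y (mem_set Ky).
apply: (@le_trans _ _ (relative_entropy xAB (product_state yA xAB))).
  by apply: ereal_inf_lbound; exists yA.
by apply: relative_entropy_le; [exact: ltW | exact: product_dominates].
Qed.
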